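(* Let $r\in\{3,4,\dots,9\}$ and $\bar r=\lceil\frac{r-1}{3}\rceil$. Let $V_r=\{v_r(k):k\in[1,r]\}$ and $W_r=\{w_r(k):k\in[1,r]\}$ be disjoint sets of $r$ colours each, with indices read modulo $r$ (i.e. $u_r(m)=u_r(n)$ for $u\in\{v,w\}$ whenever $m\equiv n\pmod r$). Let $N_r$ be the $6\times r$ matrix with entries $(N_r)_{i,j}=v_r(i+j-1)$ for $i\in[1,3]$, $j\in[1,r]$, and $(N_r)_{i,j}=w_r((i-4)\bar r+j)$ for $i\in[4,6]$, $j\in[1,r]$. Then $N_r\in\mathcal M(6,r,V_r\cup W_r)$.
   Context: For integers $m\le n$, $[m,n]=\{z\in\mathbb Z:m\le z\le n\}$. For positive integers $p,q$ and a finite set $C$, $\mathcal M(p,q,C)$ is the set of $p\times q$ matrices $M$ with entries from $C$ such that every line (row or column) of $M$ has pairwise distinct entries, and for every pair of distinct colours $\alpha,\beta\in C$ there is a line of $M$ containing both $\alpha$ and $\beta$. *)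

(* Defs.v *)
From mathcomp Require Export all_boot all_order all_algebra.
From mathcomp Require Export finmap.

Set Implicit Arguments.
Unset Strict Implicit.
Unset Printing Implicit Defensive.

Import Order.TTheory GRing.Theory Num.Theory.
Local Open Scope ring_scope.

Section Matrices.
Context {T : choiceType}.

Definition lines p q (M : 'M[T]_(p, q)) : seq (seq T) :=
  [seq [seq M i j | j : 'I_q] | i : 'I_p] ++
  [seq [seq M i j | i : 'I_p] | j : 'I_q].

Definition calM p q (C : {fset T}) (M : 'M[T]_(p, q)) : Prop :=
  [/\ forall i j, M i j \in C,
      forall l : seq T, l \in lines M -> uniq l
    & forall a b, a \in C -> b \in C -> a != b ->
        exists l : seq T, [/\ l \in lines M, a \in l & b \in l]].

End Matrices.

Definition rbar (r : nat) : int := Num.ceil ((r%:R - 1) / 3 : rat).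

Definition colour_set {T : choiceType} (r : nat) (u : int -> T) : {fset T} :=
  [fset u k%:Z | k in iota 1 r]%fset.

Definition index_mod {T : Type} (r : nat) (u : int -> T) : Prop :=
  forall m n : int, (m = n %[mod r])%Z -> u m = u n.

(* Ordinals are 0-based: the entry at (i, j) is the 1-based entry
   (i + 1, j + 1). *)
Definition Nmx {T : choiceType} (r : nat) (v w : int -> T) : 'M[T]_(6, r) :=
  \matrix_(i, j)
    let i1 : int := i.+1%:Z in
    let j1 : int := j.+1%:Z in
    if i1 <= 3 then v (i1 + j1 - 1) else w ((i1 - 4) * rbar r + j1).

(* Main.v *)
Require Import Defs.
From mathcomp Require Import all_boot all_order all_algebra.
From mathcomp Require Import finmap.
From mathcomp Require Import zify lra.

Import Order.TTheory GRing.Theory Num.Theory.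
Local Open Scope ring_scope.

(** Any two colours of [V] (resp. [W]) share the first (resp. fourth) row, which
    lists the whole set.  A pair [v s], [w t] shares a column as soon as [t - s]
    is congruent modulo [r] to some [i' * rbar r - i] with [i, i'] in [[0, 2]];
    as [rbar r <= 3], these numbers fill the integer interval
    [[- 2, 2 * rbar r]], which has at least [r] elements. *)

Lemma rbar_bounds (r : nat) : r%:Z - 1 <= 3 * rbar r < r%:Z + 2.
Proof.
rewrite /rbar; set x : rat := (r%:R - 1) / 3; set c := Num.ceil x.
have /andP[lo hi] : (c - 1)%:~R < x <= c%:~R by apply: ceil_itv.
have hx : x * 3 = r%:~R - 1 by rewrite mulfVK.
rewrite rmorphB /= in lo.
apply/andP; split.
  by rewrite -(ler_int rat) rmorphM rmorphB /=; lra.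
by rewrite -(ltr_int rat) rmorphM rmorphD /=; lra.
Qed.

Lemma modz_eq_small (r : nat) (m n : int) :
  (m = n %[mod r])%Z -> `|m - n| < r%:Z -> m = n.
Proof.
move/eqP; rewrite eqz_mod_dvd => /dvdzP[k hk] hlt.
suff k0 : k = 0 by rewrite k0 in hk; lia.
by nia.
Qed.

Lemma modz_range1 (r : nat) (m : int) : (0 < r)%N ->
  exists2 k : nat, (1 <= k <= r)%N & (k%:Z = m %[mod r])%Z.
Proof.
move=> r0; have rn0 : r%:Z != 0 by lia.
have h0 := modz_ge0 (m - 1) rn0.
have h1 : ((m - 1) %% r)%Z < r%:Z by apply: ltz_pmod; lia.
(* Reducing [m - 1] and adding 1 back moves the residues from [0, r - 1] to [1, r]. *)
exists (absz (((m - 1) %% r)%Z + 1)); first by lia.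
have -> : (absz (((m - 1) %% r)%Z + 1))%:Z = ((m - 1) %% r)%Z + 1 by lia.
by rewrite modzDml subrK.
Qed.

Lemma colour_setP (T : choiceType) (r : nat) (u : int -> T) (a : T) :
  reflect (exists2 k : nat, (1 <= k <= r)%N & a = u k%:Z)
          (a \in colour_set r u).
Proof.
rewrite /colour_set; apply: (iffP (imfsetP _ _ _ _)) => /= -[k hk ->]; exists k => //; move: hk;
  by rewrite mem_iota; lia.
Qed.

Lemma mem_colour_set (T : choiceType) (r : nat) (u : int -> T) (m : int) :
  (0 < r)%N -> index_mod r u -> u m \in colour_set r u.
Proof.
move=> r0 hu; have [k hk e] := modz_range1 _ m r0.
by apply/colour_setP; exists k => //; apply: hu.
Qed.

(** The list [u 1, ..., u r] has length [r] and takes [r] values, so it has no repetition; equal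
    colours then sit at equal positions, that is, have equal representatives in [1, r]. *)
Lemma colour_inj (T : choiceType) (r : nat) (u : int -> T) (m n : int) :
  (0 < r)%N -> index_mod r u -> #|` colour_set r u|%fset = r ->
  u m = u n -> (m = n %[mod r])%Z.
Proof.
move=> r0 hu hc.
have [k hk ek] := modz_range1 _ m r0; have [l hl el] := modz_range1 _ n r0.
rewrite -ek -el -(hu _ _ ek) -(hu _ _ el) => e; congr (Posz _ %% _)%Z.
pose s := [seq u x%:Z | x <- iota 1 r].
have us : uniq s.
  (* A list with a repetition is strictly longer than its [undup], whose size is the cardinality of
     the colour set. *)
  rewrite -[uniq s]negbK -ltn_size_undup size_map size_iota -leqNgt.
  move: hc; rewrite /colour_set unlock size_seq_fset /=.
  by rewrite (undup_id (iota_uniq _ _)) => ->.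
have nths x : (1 <= x <= r)%N -> nth (u 0) s x.-1 = u x%:Z.
  move=> hx; rewrite (nth_map 0%N) ?size_iota ?nth_iota; last by lia.
    by rewrite add1n prednK //; lia.
  by lia.
have : nth (u 0) s k.-1 == nth (u 0) s l.-1 by rewrite !nths // e.
by rewrite nth_uniq ?size_map ?size_iota; lia.
Qed.

Section Entries.
Context {T : choiceType} (r : nat) (v w : int -> T).

Lemma Nmx_v (i : 'I_6) (j : 'I_r) : (i < 3)%N ->
  Nmx r v w i j = v (i%:Z + j%:Z + 1).
Proof.
move=> hi; rewrite mxE /= ifT; last by lia.
by congr v; lia.
Qed.

Lemma Nmx_w (i : 'I_6) (j : 'I_r) : (3 <= i)%N ->
  Nmx r v w i j = w ((i%:Z - 3) * rbar r + j%:Z + 1).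
Proof.
move=> hi; rewrite mxE /= ifF; last by lia.
congr w; have -> : i.+1%:Z - 4 = i%:Z - 3 by lia.
by lia.
Qed.

End Entries.

Lemma mem_row_lines {T : choiceType} {p q : nat} (M : 'M[T]_(p, q)) (i : 'I_p) :
  [seq M i j | j : 'I_q] \in lines M.
Proof.
by rewrite mem_cat; apply/orP; left; apply/mapP; exists i; rewrite ?mem_enum.
Qed.

Lemma mem_col_lines {T : choiceType} {p q : nat} (M : 'M[T]_(p, q)) (j : 'I_q) :
  [seq M i j | i : 'I_p] \in lines M.
Proof.
by rewrite mem_cat; apply/orP; right; apply/mapP; exists j; rewrite ?mem_enum.
Qed.

Lemma diff_cover (r : nat) (b d : int) :
  0 < b <= 3 -> (0 < r)%N -> r%:Z <= 2 * b + 3 ->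
  exists i i' : nat, [/\ (i < 3)%N, (i' < 3)%N
    & (i'%:Z * b - i%:Z = d %[mod r])%Z].
Proof.
move=> hb r0 hr; have rn0 : r%:Z != 0 by lia.
have h0 := modz_ge0 d rn0.
have h1 : (d %% r)%Z < r%:Z by apply: ltz_pmod; lia.
(* A residue above [2 * b] is lowered by [r]; as [r <= 2 * b + 3], the result is at least -2. *)
have [e [he ed]] : exists e : int, - 2 <= e <= 2 * b /\ (e = d %[mod r])%Z.
  have [le|gt] := lerP (d %% r)%Z (2 * b).
    by exists (d %% r)%Z; split; [lia | rewrite modz_mod].
  by exists ((d %% r)%Z - r%:Z); split; [lia | rewrite -mulN1r addrC modzMDl modz_mod].
suff [i [i' [hi hi' ei]]] : exists i i' : nat,
    [/\ (i < 3)%N, (i' < 3)%N & i'%:Z * b - i%:Z = e].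
  by exists i, i'; rewrite ei.
(* For [i'] = 0, 1, 2 the values reached are [-2, 0], [b - 2, b] and [2b - 2, 2b]; since [b <= 3],
   they leave no gap. *)
have [?|?] := lerP e 0; first by exists (absz e), 0%N; split; lia.
have [?|?] := lerP e b; first by exists (absz (b - e)%R), 1%N; split; lia.
by exists (absz (2 * b - e)%R), 2%N; split; lia.
Qed.

Theorem lemma5 (T : choiceType) (r : nat) (v w : int -> T)
  (hr : (3 <= r <= 9)%N)
  (hv : index_mod r v) (hw : index_mod r w)
  (hV : #|` colour_set r v |%fset = r) (hW : #|` colour_set r w |%fset = r)
  (hVW : [disjoint colour_set r v & colour_set r w]%fset) :
  calM (colour_set r v `|` colour_set r w)%fset (Nmx r v w).
Proof.
have r0 : (0 < r)%N by lia.
have hb := rbar_bounds r.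
have b0 : 0 < rbar r <= 3 by lia.
(* [b2] keeps the three [w] entries of a column apart; [b3] says that the interval from -2 to
   [2 * rbar r] has at least [r] elements. *)
have b2 : 2 * rbar r < r%:Z by lia.
have b3 : r%:Z <= 2 * rbar r + 3 by lia.
have vw m n : v m <> w n.
  move=> e; have := fdisjointP hVW _ (mem_colour_set _ _ _ m r0 hv).
  by rewrite e mem_colour_set.
have injv m n : v m = v n -> `|m - n| < r%:Z -> m = n.
  by move/(colour_inj _ _ _ _ _ r0 hv hV)/modz_eq_small; apply.
have injw m n : w m = w n -> `|m - n| < r%:Z -> m = n.
  by move/(colour_inj _ _ _ _ _ r0 hw hW)/modz_eq_small; apply.
split.
- move=> i j; rewrite in_fsetU.
  have [hi|hi] := ltnP i 3; first by rewrite Nmx_v // mem_colour_set.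
  by rewrite Nmx_w // mem_colour_set ?orbT.
- move=> l; rewrite mem_cat => /orP[] /mapP[x _ ->];
    rewrite map_inj_uniq ?enum_uniq // => y z.
  + move=> e; apply/val_inj => /=; move: e (ltn_ord y) (ltn_ord z).
    have [hx|hx] := ltnP x 3; first by rewrite !Nmx_v // => /injv; lia.
    (* Both entries carry the same shift [c], so their indices differ by the difference of the
       columns, which is below [r]. *)
    by rewrite !Nmx_w //; set c := _ * rbar r => /injw; lia.
  + move=> e; apply/val_inj => /=; move: e (ltn_ord y) (ltn_ord z).
    have [hy|hy] := ltnP y 3; have [hz|hz] := ltnP z 3.
    * by rewrite !Nmx_v // => /injv; lia.
    * by rewrite Nmx_v // Nmx_w // => e; case: (vw _ _ e).
    * by rewrite Nmx_w // Nmx_v // => e; case: (vw _ _ (esym e)).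
    (* Fixing the value of [rbar r] makes the products linear for [lia]; the indices differ by at
       most [2 * rbar r < r]. *)
    * rewrite !Nmx_w //; have : rbar r \in [:: 1; 2; 3] by rewrite !inE; lia.
      by rewrite !inE => /or3P[] /eqP e; move: b2; rewrite e => ? /injw; lia.
- have vv k : (1 <= k <= r)%N -> v k%:Z \in [seq Nmx r v w ord0 j | j : 'I_r].
    move=> hk; have hk' : (k.-1 < r)%N by lia.
    apply/mapP; exists (Ordinal hk'); rewrite ?mem_enum // Nmx_v //=.
    by congr v; lia.
  pose i3 : 'I_6 := @Ordinal 6 3 isT.
  have ww k : (1 <= k <= r)%N -> w k%:Z \in [seq Nmx r v w i3 j | j : 'I_r].
    move=> hk; have hk' : (k.-1 < r)%N by lia.
    apply/mapP; exists (Ordinal hk'); rewrite ?mem_enum // Nmx_w //=.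
    by congr w; lia.
  have vwcol s t : exists l, [/\ l \in lines (Nmx r v w), v s \in l & w t \in l].
    have [i [i' [hi hi' e]]] := diff_cover r (rbar r) (t - s) b0 r0 b3.
    (* The column, 1-based [k], is chosen so that row [i] (0-based) holds [v (k + i)], which is
       [v s]; row [i' + 3] then holds [w (k + i' * rbar r)], which is [w t] by the choice of [i] and
       [i']. *)
    have [k hk ek] := modz_range1 _ (s - i%:Z) r0.
    have ki : (k%:Z + i%:Z = s %[mod r])%Z by rewrite -modzDml ek modzDml subrK.
    have hk' : (k.-1 < r)%N by lia.
    exists [seq Nmx r v w x (Ordinal hk') | x : 'I_6].
    split; first exact: mem_col_lines.
    + have h6 : (i < 6)%N by lia.
      apply/mapP; exists (Ordinal h6); rewrite ?mem_enum // Nmx_v //=.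
      apply: hv; have -> : i%:Z + k.-1%:Z + 1 = k%:Z + i%:Z by lia.
      by rewrite ki.
    + have h6 : (i' + 3 < 6)%N by lia.
      apply/mapP; exists (Ordinal h6); rewrite ?mem_enum // Nmx_w //=; last by lia.
      apply: hw.
      have -> : ((i' + 3)%N%:Z - 3) * rbar r + k.-1%:Z + 1 =
        (k%:Z + i%:Z) + (i'%:Z * rbar r - i%:Z) by lia.
      by rewrite -modzDm ki e modzDm addrCA subrr addr0.
  move=> a b; rewrite !in_fsetU => /orP[] /colour_setP[s hs ->]
    /orP[] /colour_setP[t ht ->] _.
  + by exists [seq Nmx r v w ord0 j | j : 'I_r]; rewrite mem_row_lines !vv.
  + exact: vwcol.
  + by have [l [? ? ?]] := vwcol t%:Z s%:Z; exists l.
  + by exists [seq Nmx r v w i3 j | j : 'I_r]; rewrite mem_row_lines !ww.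
Qed.
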